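(* For all integers $n\ge 0$, $h\ge 0$ and $k\ge 1$, $$\left|A_{(n,h)}^k\right|=\binom{n}{\frac{n+h+2k-2s}{2}}-\binom{n}{\frac{n+h+2k}{2}+1},$$ where $s=\min\{k-1,h\}$.
   Context: A generalized Dyck path from $(0,0)$ to $(n,h)$ is a lattice path with northeast steps $(1,1)$ and southeast steps $(1,-1)$ from $(0,0)$ to $(n,h)$ that never goes below the $x$-axis; it is recorded by its heights $(a_0=0,a_1,\dots,a_n=h)$. $\mathcal{D}_{(n,h)}$ is the set of all generalized Dyck paths from $(0,0)$ to $(n,h)$. $A_{(n,h)}^k$ is the set of pairs $(D,i)$ with $D\in\mathcal{D}_{(n,h)}$ and $a_i=k$, $a_{i+1}=k-1$, where $a_t$ are the heights of $D$; that is, the set of all $k$-down steps (southeast steps from height $k$ to height $k-1$) in all paths in $\mathcal{D}_{(n,h)}$. Convention: $\binom{a}{b}=0$ if $a<b$ or if $a,b$ are not non-negative integers. *)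

(* Defs.v *)
From HB Require Import structures.
From mathcomp Require Import all_boot all_order all_algebra.

Set Implicit Arguments.
Unset Strict Implicit.
Unset Printing Implicit Defensive.

Import Order.TTheory GRing.Theory Num.Theory.

Local Open Scope ring_scope.

(* A path with n steps is given by its sequence of steps: [true] is the
   northeast step (1,1), [false] the southeast step (1,-1). *)
Definition step_rise (b : bool) : int := if b then 1 else -1.

(* Meaningful for t <= n; constant in t afterwards. *)
Definition height (n : nat) (D : n.-tuple bool) (t : nat) : int :=
  \sum_(j < n | (j < t)%N) step_rise (tnth D j).

Definition gen_dyck (n h : nat) : {set n.-tuple bool} :=
  [set D | [forall t : 'I_n.+1, 0 <= height D t] & height D n == h%:Z].

Definition down_steps (n h k : nat) : {set (n.-tuple bool * 'I_n)} :=
  [set Di : n.-tuple bool * 'I_n |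
    [&& Di.1 \in gen_dyck n h,
        height Di.1 Di.2 == k%:Z
      & height Di.1 Di.2.+1 == k%:Z - 1]].

(* Zero unless a and b are nonnegative integers; 'C(a, b) is already zero
   when a < b. *)
Definition binq (a b : rat) : int :=
  if (a \is a Num.nat) && (b \is a Num.nat)
  then ('C(Num.truncn a, Num.truncn b))%:Z else 0.

(* Main.v *)
(** Split off the last step. The numbers of nonnegative paths ending at [x] and
    of their marked [k]-down steps satisfy [f(n+1,x) = f(n,x-1) + f(n,x+1)], up
    to an extra source term at [x = k-1] for the down steps: the marked step may
    be the last one. The number [w(n,x)] of unconstrained walks ending at [x],
    a binomial coefficient, satisfies the same recurrence and is even in [x].
    Hence the formulas [w(n,x) - w(n,x+2)] and
    [w(n,x+2k-2s) - w(n,x+2k+2)], with [s = min(k-1,x)], follow by induction on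
    [n] for all [x >= -1]: all four quantities vanish at [x = -1]. *)
Require Import Defs.
From mathcomp Require Import all_boot all_order all_algebra.
From mathcomp Require Import zify ring.

Import Order.TTheory GRing.Theory Num.Theory.

Local Open Scope ring_scope.

Lemma height_rcons (n : nat) (D : n.-tuple bool) (b : bool) (t : nat) :
  height [tuple of rcons D b] t =
    height D t + (if (n < t)%N then step_rise b else 0).
Proof.
rewrite /height big_mkcond big_ord_recr /= [in RHS]big_mkcond /=; congr (_ + _).
  apply: eq_bigr => j _; rewrite !(tnth_nth true) /= nth_rcons size_tuple.
  by rewrite ltn_ord.
by rewrite (tnth_nth true) /= nth_rcons size_tuple ltnn eqxx.
Qed.

(** Needed because [height_rcons] at time [n.+1] produces [height D n.+1], past the end of [D],
    where the height is frozen. *)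
Lemma height_ge (n : nat) (D : n.-tuple bool) (t : nat) :
  (n <= t)%N -> height D t = height D n.
Proof.
by move=> le_nt; apply: eq_bigl => j; rewrite ltn_ord (leq_trans (ltn_ord j)).
Qed.

Definition nonneg_path {n : nat} (D : n.-tuple bool) : bool :=
  [forall t : 'I_n.+1, 0 <= height D t].

Lemma nonneg_path_rcons (n : nat) (D : n.-tuple bool) (b : bool) :
  nonneg_path [tuple of rcons D b] =
    nonneg_path D && (0 <= height D n + step_rise b).
Proof.
apply/forallP/andP => [ge0 | [/forallP ge0 ge0_last] t].
  split; last by have := ge0 ord_max; rewrite height_rcons ltnSn height_ge.
  apply/forallP => t; have := ge0 (widen_ord (leqnSn _) t).
  by rewrite height_rcons /= ltnNge -ltnS ltn_ord addr0.
rewrite height_rcons; case: ltnP => [lt_nt | le_tn].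
  by rewrite height_ge // ltnW.
by rewrite addr0; have := ge0 (Ordinal (le_tn : (t < n.+1)%N)).
Qed.

Lemma big_tuple_rcons (n : nat) (F : n.+1.-tuple bool -> int) :
  \sum_D F D = \sum_(D : n.-tuple bool)
    (F [tuple of rcons D true] + F [tuple of rcons D false]).
Proof.
pose f (p : n.-tuple bool * bool) := [tuple of rcons p.1 p.2].
have f_inj : injective f.
  move=> [D b] [E c] /(congr1 val) /= /rcons_inj[eqDE ->].
  by congr (_, _); apply: val_inj.
have f_bij : bijective f.
  by apply: (inj_card_bij f_inj); rewrite card_prod !card_tuple card_bool expnS mulnC.
rewrite (reindex f) /=; last exact: onW_bij.
rewrite (eq_bigr (fun p => F (f (p.1, p.2)))) => [|[] //].
rewrite -(pair_bigA _ (fun D b => F (f (D, b)))) /=.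
by apply: eq_bigr => D _; rewrite big_bool.
Qed.

(** The endpoint is an integer so that the recurrence at [x = 0] can refer to [x - 1 = -1]. *)
Definition dyck_num (n : nat) (x : int) : int :=
  \sum_(D : n.-tuple bool) (nonneg_path D && (height D n == x))%:R.

Definition down_step_num (k n : nat) (x : int) : int :=
  \sum_(D : n.-tuple bool) \sum_(i < n)
    (nonneg_path D && (height D n == x) &&
     ((height D i == k%:Z) && (height D i.+1 == k%:Z - 1)))%:R.

Lemma nonneg_path_ge0 (n : nat) (D : n.-tuple bool) :
  nonneg_path D -> 0 <= height D n.
Proof. by move/forallP/(_ ord_max). Qed.

Lemma dyck_num_lt0 (n : nat) (x : int) : x < 0 -> dyck_num n x = 0.
Proof.
move=> x_lt0; apply: big1 => D _; case: andP => // -[/nonneg_path_ge0 + /eqP hx].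
by rewrite hx leNgt x_lt0.
Qed.

Lemma down_step_num_lt0 (k n : nat) (x : int) :
  x < 0 -> down_step_num k n x = 0.
Proof.
move=> x_lt0; apply: big1 => D _; apply: big1 => i _.
case: eqP => [hx | _]; rewrite ?andbF // andbT.
by case: nonneg_path (@nonneg_path_ge0 _ D) => // /(_ isT); rewrite hx leNgt x_lt0.
Qed.

(** Since [0 <= x], the new last height satisfies the constraint by itself, so only the prefix has
    to be nonnegative. *)
Lemma nonneg_path_rcons_end (n : nat) (D : n.-tuple bool) (b : bool) (x : int) :
  0 <= x ->
  nonneg_path [tuple of rcons D b] && (height [tuple of rcons D b] n.+1 == x) =
    nonneg_path D && (height D n == x - step_rise b).
Proof.
move=> x_ge0; rewrite nonneg_path_rcons height_rcons ltnSn height_ge // -andbA.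
rewrite eq_sym -subr_eq eq_sym; case: eqP => [-> | _]; last by rewrite !andbF.
by rewrite subrK x_ge0.
Qed.

Lemma dyck_numS (n : nat) (x : int) :
  0 <= x -> dyck_num n.+1 x = dyck_num n (x - 1) + dyck_num n (x + 1).
Proof.
move=> x_ge0; rewrite /dyck_num big_tuple_rcons -big_split /=.
by apply: eq_bigr => D _; rewrite !nonneg_path_rcons_end //= opprK.
Qed.

Lemma down_step_numS (k n : nat) (x : int) :
  0 <= x ->
  down_step_num k n.+1 x =
    down_step_num k n (x - 1) + down_step_num k n (x + 1)
    + (x == k%:Z - 1)%:R * dyck_num n k%:Z.
Proof.
move=> x_ge0; rewrite /down_step_num big_tuple_rcons /dyck_num mulr_sumr.
rewrite -!big_split /=; apply: eq_bigr => D _.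
rewrite !big_ord_recr /= !nonneg_path_rcons_end // !height_rcons ltnn ltnSn /=.
rewrite !addr0 height_ge // opprK addrACA; congr (_ + _ + _).
(* A mark before the last step involves only heights up to time [n], which the new step leaves
   unchanged. *)
1,2: by apply: eq_bigr => i _;
  rewrite !height_rcons ltnS ltnNge (leqNgt n i) ltn_ord ltnW //= ?addr0.
(* The mark is on the last step: a rise never qualifies, and a fall does exactly when [D] ends at
   [k] and [x = k - 1]. *)
rewrite -natrM mulnb -natrD.
case: nonneg_path; rewrite ?andbF //=.
by congr (_%:R); lia.
Qed.

(** A walk ending at [x] has [(n + x) / 2] rises; a wrong parity or [|x| > n] gives zero through the
    convention in [binq]. *)
Definition walk_num (n : nat) (x : int) : int :=
  binq n%:R ((n%:R + x%:~R) / 2).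

Lemma binq_nat (n m : nat) : binq n%:R m%:R = ('C(n, m))%:Z.
Proof. by rewrite /binq !natr_nat !natrK. Qed.

Lemma binq_notnat (n : nat) (b : rat) : b \isn't a Num.nat -> binq n%:R b = 0.
Proof. by rewrite /binq => /negPf->; rewrite andbF. Qed.

(** Pascal's rule survives the zero convention: at [b = 0] the second term vanishes, and if [b] is
    not natural then neither is [b - 1]. *)
Lemma binqS (n : nat) (b : rat) :
  binq n.+1%:R b = binq n%:R b + binq n%:R (b - 1).
Proof.
have [/natrP[[|m] ->] | bN] := boolP (b \is a Num.nat).
- by rewrite !binq_nat !bin0 binq_notnat ?addr0 //.
- by rewrite -(natr1 m) addrK natr1 !binq_nat binS.
rewrite !binq_notnat ?addr0 //; apply: contra bN => bN.
by rewrite -(subrK 1 b) rpredD ?rpred1.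
Qed.

Lemma binq_sub (n : nat) (b : rat) : binq n%:R (n%:R - b) = binq n%:R b.
Proof.
(* Natural lower arguments suffice: if only [n - b] is natural, apply the claim to it, as
   subtraction from [n] is an involution. *)
suff sub_nat (m : nat) : binq n%:R (n%:R - m%:R) = binq n%:R m%:R.
  have [/natrP[m ->] // | bN] := boolP (b \is a Num.nat).
  have [/natrP[m def_m] | cN] := boolP (n%:R - b \is a Num.nat).
    by rewrite def_m -sub_nat -def_m subKr.
  by rewrite !binq_notnat.
have [le_mn | lt_nm] := leqP m n; first by rewrite -natrB // !binq_nat bin_sub.
rewrite binq_nat bin_small // binq_notnat //.
by apply/negP => /natr_ge0; rewrite subr_ge0 ler_nat leqNgt lt_nm.
Qed.

Lemma walk_numS (n : nat) (x : int) :
  walk_num n.+1 x = walk_num n (x - 1) + walk_num n (x + 1).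
Proof.
rewrite /walk_num binqS addrC; congr (binq _ _ + binq _ _);
  by rewrite -natr1 ?rmorphB ?rmorphD /=; field.
Qed.

Lemma walk_numN (n : nat) (x : int) : walk_num n (- x) = walk_num n x.
Proof.
rewrite /walk_num -binq_sub; congr (binq _ _).
by rewrite rmorphN /=; field.
Qed.

Lemma walk_num0 (x : int) : walk_num 0 x = (x == 0)%:R.
Proof.
rewrite /walk_num add0r.
have [-> | x_neq0] := eqVneq x 0; first by rewrite mul0r (binq_nat 0 0).
have [/natrP[m def_m] | ?] := boolP (x%:~R / 2 \is a @Num.nat rat); last first.
  by rewrite binq_notnat.
rewrite def_m binq_nat; case: m def_m => [|m] // /eqP.
by rewrite mulf_eq0 intr_eq0 (negPf x_neq0).
Qed.

Lemma height0 (D : 0.-tuple bool) (t : nat) : height D t = 0.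
Proof. by rewrite /height big_ord0. Qed.

Lemma dyck_num0 (x : int) : dyck_num 0 x = (x == 0)%:R.
Proof.
rewrite /dyck_num (big_pred1 [tuple]) => [|D]; last by apply/esym/eqP/tuple0.
rewrite height0 (eq_sym x) (_ : nonneg_path _ = true) //.
by apply/forallP => t; rewrite height0.
Qed.

(** This is the reflection principle: [walk_num] is even, and [-(x + 2)] is the mirror image of [x]
    in height -1. *)
Lemma dyck_numE (n : nat) (x : int) :
  -1 <= x -> dyck_num n x = walk_num n x - walk_num n (x + 2).
Proof.
elim: n x => [|n IHn] x x_geN1; have [-> | x_neqN1] := eqVneq x (-1).
- by rewrite dyck_num_lt0 // walk_numN subrr.
- by rewrite dyck_num0 !walk_num0 (_ : (x + 2 == 0) = false) ?subr0 //; lia.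
- by rewrite dyck_num_lt0 // walk_numN subrr.
have x_ge0 : 0 <= x by lia.
rewrite dyck_numS // !IHn ?walk_numS; try lia.
have -> : x - 1 + 2 = x + 2 - 1 by lia.
have -> : x + 1 + 2 = x + 2 + 1 by lia.
by ring.
Qed.

Lemma down_step_numE (k n : nat) (x : int) :
  (0 < k)%N -> -1 <= x ->
  down_step_num k n x =
    walk_num n (x + 2 * k%:Z - 2 * Num.min (k%:Z - 1) x)
    - walk_num n (x + 2 * k%:Z + 2).
Proof.
move=> k_gt0; elim: n x => [|n IHn] x x_geN1.
  rewrite /down_step_num big1 => [|D _]; last by rewrite big_ord0.
  (* Both arguments are positive; the first is [2k - x] for [x <= k - 1] and [x + 2] otherwise. *)
  rewrite !walk_num0 (_ : (x + 2 * k%:Z + 2 == 0) = false); last by lia.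
  by rewrite (_ : (_ == 0) = false) //; lia.
have [-> | x_neqN1] := eqVneq x (-1).
  rewrite down_step_num_lt0 // (_ : Num.min _ _ = -1); last by lia.
  by rewrite (_ : -1 + 2 * k%:Z + 2 = -1 + 2 * k%:Z - 2 * -1) ?subrr //; lia.
have x_ge0 : 0 <= x by lia.
rewrite down_step_numS // dyck_numE; last by lia.
rewrite !IHn; try lia.
rewrite !walk_numS.
have -> : x - 1 + 2 * k%:Z + 2 = x + 2 * k%:Z + 2 - 1 by lia.
have -> : x + 1 + 2 * k%:Z + 2 = x + 2 * k%:Z + 2 + 1 by lia.
(* Below the kink of the minimum at [k - 1] the first argument is [2k - x], so the two neighbours of
   [x] swap roles; above it the argument is [x + 2]. *)
have [lt_xk | le_kx] := ltP x (k%:Z - 1).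
  rewrite !min_r; try lia.
  rewrite lt_eqF // mul0r addr0.
  have -> : x - 1 + 2 * k%:Z - 2 * (x - 1) = x + 2 * k%:Z - 2 * x + 1 by lia.
  have -> : x + 1 + 2 * k%:Z - 2 * (x + 1) = x + 2 * k%:Z - 2 * x - 1 by lia.
  by ring.
(* At the kink both neighbours give [k + 2], while [k] and [k + 2] are wanted; the source
   [w(n,k) - w(n,k+2)] makes up the difference. *)
have [def_x | x_neq] := eqVneq x (k%:Z - 1).
  rewrite !(min_l (_ : _ <= x + 1)) ?min_r ?def_x; try lia.
  have -> : k%:Z - 1 - 1 + 2 * k%:Z - 2 * (k%:Z - 1 - 1) = k%:Z + 2 by lia.
  have -> : k%:Z - 1 + 1 + 2 * k%:Z - 2 * (k%:Z - 1) = k%:Z + 2 by lia.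
  have -> : k%:Z - 1 + 2 * k%:Z - 2 * (k%:Z - 1) - 1 = k%:Z by lia.
  have -> : k%:Z - 1 + 2 * k%:Z - 2 * (k%:Z - 1) + 1 = k%:Z + 2 by lia.
  by rewrite mul1r; ring.
rewrite !min_l; try lia.
rewrite mul0r addr0.
have -> : x - 1 + 2 * k%:Z - 2 * (k%:Z - 1) = x + 2 * k%:Z - 2 * (k%:Z - 1) - 1.
  by lia.
have -> : x + 1 + 2 * k%:Z - 2 * (k%:Z - 1) = x + 2 * k%:Z - 2 * (k%:Z - 1) + 1.
  by lia.
by ring.
Qed.

Lemma card_down_steps (n h k : nat) :
  #|down_steps n h k|%:Z = down_step_num k n h%:Z.
Proof.
rewrite -sum1_card -natz natr_sum big_mkcond /down_step_num pair_bigA /=.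
by apply: eq_bigr => -[D i] _; rewrite !inE /= /nonneg_path; case: (_ && _).
Qed.

Theorem theorem5p1 (n h k : nat) (hk : (1 <= k)%N) :
  let s := minn (k - 1) h in
  #|down_steps n h k|%:Z =
    binq n%:R ((n%:R + h%:R + 2 * k%:R - 2 * s%:R) / 2)
    - binq n%:R ((n%:R + h%:R + 2 * k%:R) / 2 + 1).
Proof.
move=> s; rewrite card_down_steps down_step_numE //.
have -> : Num.min (k%:Z - 1) h%:Z = s%:Z by rewrite /s; lia.
rewrite /walk_num; congr (binq _ _ - binq _ _);
  by rewrite ?(rmorphB, rmorphD, rmorphM) /= -!pmulrn; field.
Qed.
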